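(* For all integers $n\geq m\geq 3$, $s_1^u(P_m\square P_n)=2m$.
   Context: $P_m$ is the path on $m$ vertices. The Cartesian product $G_1\square G_2$ has vertex set $V(G_1)\times V(G_2)$, with $(u,v)$ and $(u',v')$ adjacent iff ($u=u'$ and $vv'\in E(G_2)$) or ($v=v'$ and $uu'\in E(G_1)$). All graphs are finite, simple and connected. $\Delta(G)$ is the maximum degree of $G=(V,E)$; $N[x]$ is the closed neighborhood of $x$ and $N[X]=\bigcup_{x\in X}N[x]$. For nonempty $S\subseteq V$: $Bord(S)=\{x\in S: N[x]-S\neq\emptyset\}$ and $\partial S=N[S]-S$. For a nonempty proper subset $S$ of $V$: an attack on $S$ is a function $A:\partial S\to Bord(S)$ such that each $x\in\partial S$ is adjacent to $A(x)$; a defense of $S$ is a function $D:N[Bord(S)]\cap S\to Bord(S)$ such that for each $y$ in the domain, $D(y)=y$ or $D(y)$ is adjacent to $y$. For $0\le k<\Delta(G)$, a defense $D$ of $S$ is an ultra $k$-defense if for every attack $A$ on $S$, $|D^{-1}(x)|-|A^{-1}(x)|\geq k$ for all $x\in Bord(S)$. A nonempty set $S\subseteq V$ is an ultra $k$-secure set if $S=V$ or $S$ has an ultra $k$-defense. The ultra $k$-security number $s_k^u(G)$ is the minimum cardinality of an ultra $k$-secure set in $G$. *)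

(* Defs.v *)
From mathcomp Require Import all_boot.

Set Implicit Arguments.
Unset Strict Implicit.
Unset Printing Implicit Defensive.

Record graph := Graph {
  vertex :> finType;
  adj : rel vertex;
  adj_sym : symmetric adj;
  adj_irr : irreflexive adj;
  adj_connected : forall x y, connect adj x y }.

Definition path_adj (m : nat) : rel 'I_m :=
  fun i j => (i.+1 == j :> nat) || (j.+1 == i :> nat).

Lemma path_adj_sym m : symmetric (@path_adj m).
Proof. by move=> i j; rewrite /path_adj orbC. Qed.

Lemma path_adj_irr m : irreflexive (@path_adj m).
Proof. by move=> i; rewrite /path_adj orbb eqn_leq ltnn. Qed.

Lemma path_adj_connected m (i j : 'I_m) : connect (@path_adj m) i j.
Proof.
have up (d : nat) (k l : 'I_m) : k + d = l :> nat -> connect (@path_adj m) k l.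
  elim: d l => [|d IHd] l; first by rewrite addn0 => /val_inj ->.
  rewrite addnS => kdl.
  have lt_kd : k + d < m by rewrite kdl ltnW.
  apply: connect_trans (IHd (Ordinal lt_kd) erefl) _.
  by apply: connect1; rewrite /path_adj /= kdl eqxx.
have [le_ij|/ltnW le_ji] := leqP i j; first exact: up (subnKC le_ij).
by rewrite (sym_connect_sym (@path_adj_sym m)); exact: up (subnKC le_ji).
Qed.

Definition path_graph (m : nat) : graph :=
  Graph (@path_adj_sym m) (@path_adj_irr m) (@path_adj_connected m).

Section CartesianProduct.
Variables G1 G2 : graph.

Definition cart_adj : rel (G1 * G2) :=
  fun p q => (p.1 == q.1) && adj p.2 q.2 || (p.2 == q.2) && adj p.1 q.1.

Lemma cart_adj_sym : symmetric cart_adj.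
Proof.
move=> p q; rewrite /cart_adj.
by rewrite (eq_sym p.1) (eq_sym p.2) (adj_sym p.1) (adj_sym p.2).
Qed.

Lemma cart_adj_irr : irreflexive cart_adj.
Proof. by move=> p; rewrite /cart_adj !adj_irr !andbF. Qed.

Lemma cart_adj_connected p q : connect cart_adj p q.
Proof.
case: p q => [u v] [u' v']; apply: (@connect_trans _ _ (u', v)).
  have /connectP[s + ->] := adj_connected u u'.
  elim: s u => //= w s IHs u /andP[uw /IHs]; apply: connect_trans.
  by apply: connect1; rewrite /cart_adj /= eqxx uw orbT.
have /connectP[s + ->] := adj_connected v v'.
elim: s v => //= w s IHs v /andP[vw /IHs]; apply: connect_trans.
by apply: connect1; rewrite /cart_adj /= eqxx vw.
Qed.

Definition cart_graph : graph :=
  Graph cart_adj_sym cart_adj_irr cart_adj_connected.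

End CartesianProduct.

Notation "G1 □ G2" := (cart_graph G1 G2) (at level 40, left associativity).

Section UltraSecurity.
Variable G : graph.
Implicit Types (S X : {set G}) (A D : {ffun G -> G}).

Definition max_degree : nat := \max_(x : G) #|[set y | adj x y]|.

Definition closed_nbh (x : G) : {set G} := [set y | (y == x) || adj x y].

Definition closed_nbhs X : {set G} := \bigcup_(x in X) closed_nbh x.

Definition bord S : {set G} := [set x in S | closed_nbh x :\: S != set0].

Definition boundary S : {set G} := closed_nbhs S :\: S.

Definition defense_dom S : {set G} := closed_nbhs (bord S) :&: S.

(* Attacks and defenses are functions on subsets of G, represented by total
   functions whose values outside the intended domain are irrelevant; [fiber]
   accordingly only counts preimages lying in that domain. *)
Definition attack S A : bool :=
  [forall x in boundary S, (A x \in bord S) && adj x (A x)].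

Definition defense S D : bool :=
  [forall y in defense_dom S,
    (D y \in bord S) && ((D y == y) || adj y (D y))].

Definition fiber X (f : {ffun G -> G}) (x : G) : {set G} :=
  [set y in X | f y == x].

(* |D^-1(x)| - |A^-1(x)| >= k is written additively, since subtraction on nat
   is truncated. The notion is only meaningful for 0 <= k < max_degree. *)
Definition ultra_defense (k : nat) S D : bool :=
  [&& k < max_degree, defense S D &
    [forall A, attack S A ==>
      [forall x in bord S,
        #|fiber (boundary S) A x| + k <= #|fiber (defense_dom S) D x|]]].

Definition ultra_secure (k : nat) S : bool :=
  (S != set0) && ((S == setT) || [exists D, ultra_defense k S D]).

(* The seed setT of the minimum is ultra k-secure whenever G has a vertex. *)
Definition ultra_security_number (k : nat) : nat :=
  #|[arg min_(S < setT | ultra_secure k S) #|S|]|.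

End UltraSecurity.

(* Main.v *)
Require Import Defs.
From mathcomp Require Import all_boot.
From mathcomp Require Import zify.

Set Implicit Arguments.
Unset Strict Implicit.
Unset Printing Implicit Defensive.

(** The attack enters only through a local demand: sending every outside
    neighbour of one border vertex x to x is part of some attack, so an ultra
    1-defense D must give x at least one more guard than x has neighbours
    outside S, the guards of x being the vertices that D sends to x
    ([guards_demand]). Guard sets of distinct vertices are disjoint, so a set X
    of vertices of S that each have a neighbour outside S forces
    2 |X| <= |S| ([leq_demand_card]).

    Lower bound, for S other than the whole grid. If S misses both a row and a
    column, these two lines cut the grid into quadrants, one of which meets S.
    There, let x in S be farthest from the corner of the grid that lies in the
    quadrant. The two steps away from that corner leave S, so x needs three
    guards: they are x and its two neighbours y and z on the corner side.
    Neither y nor z guards itself. The neighbour of y or z that is diagonal to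
    x and as far from the corner as x is outside S, since two farthest
    vertices would compete for a guard. So y and z each need two guards, and
    the only candidates left force their common neighbour, the fourth vertex
    of the unit square, to guard both, which is absurd ([quadrant_empty]).
    Hence S meets every row or every column, say every row. If no row is full,
    each row contains a vertex of S with a neighbour outside S, and counting
    gives |S| at least twice the number of rows. A full row makes S meet every
    column, so the same argument applies to the columns, unless a column is
    full too. A full row and a full column have m + n - 1 vertices together;
    if S were smaller than 2 min(m, n) it would be exactly this cross, whose
    vertices other than the centre all have neighbours outside, and counting
    rules this out ([full_row_col]).

    Upper bound. The set S of the two columns at one end, with both vertices of
    each row guarding the inner one, is ultra 1-secure, since an inner vertex
    has only one neighbour outside S.

    The symmetries of the grid are handled by charts: a pair of coordinate
    functions that identifies the graph with the grid. Transposing a chart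
    gives a chart, and reflecting the paths gives the four charts that reduce
    any quadrant to the one at the origin. *)

(** * Guards and counting *)

Section Guards.
Variables (G : graph) (k : nat) (S : {set G}) (D : {ffun G -> G}).
Hypothesis defD : ultra_defense k S D.

Definition guards (x : G) : {set G} := fiber (defense_dom S) D x.

Lemma bord_out x y : x \in S -> y \notin S -> adj x y -> x \in bord S.
Proof.
move=> xS yS xy; rewrite inE xS; apply/set0Pn; exists y.
by rewrite !inE yS xy orbT.
Qed.

Lemma guardP x t : t \in guards x ->
  [/\ t \in S, D t = x & t = x \/ adj x t].
Proof.
case/and3P: defD => _ /forall_inP dD _; rewrite /guards inE => /andP[dt /eqP Dt].
have tS : t \in S by move: dt; rewrite inE => /andP[].
case/andP: (dD t dt); rewrite Dt => _ /orP[/eqP->|]; first by split=> //; left.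
by rewrite adj_sym => ?; split=> //; right.
Qed.

(** The demand of x is reached by the greedy attack that sends to x all the
    attackers adjacent to x, and the others anywhere they can go. [O] may be
    any set of known outside neighbours. *)
Lemma guards_demand x (O : {set G}) : x \in bord S ->
  {in O, forall y, adj x y && (y \notin S)} -> #|O| + k <= #|guards x|.
Proof.
move=> xB outO; case/and3P: defD => _ _ /forallP defA.
pose A := [ffun y => if adj x y then x else odflt x [pick z in S | adj y z]].
have attA : attack S A.
  apply/forall_inP=> y; rewrite inE => /andP[yS /bigcupP[z zS]].
  rewrite inE => yz; rewrite ffunE; case: ifP => [xy|_].
    by rewrite xB adj_sym.
  have zy : adj y z.
    by case/orP: yz => [/eqP yz|]; [rewrite yz zS in yS | rewrite adj_sym].
  case: pickP => [w /andP[wS yw]|/(_ z)]; last by rewrite zS zy.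
  by rewrite yw (@bord_out w y) // adj_sym.
apply: leq_trans (forall_inP (implyP (defA A) attA) x xB).
rewrite leq_add2r; apply/subset_leq_card/subsetP => y /outO/andP[xy yS].
rewrite !inE yS ffunE xy eqxx !andbT /=; apply/bigcupP; exists x.
  by move: xB; rewrite inE => /andP[].
by rewrite inE xy orbT.
Qed.

(** Summing the demands over X counts each vertex of S at most once, because a
    vertex guards a single vertex. *)
Lemma leq_demand_card (X : {set G}) : X \subset S ->
  {in X, forall x, exists2 y, adj x y & y \notin S} -> #|X| * k.+1 <= #|S|.
Proof.
move=> /subsetP XS outX; rewrite -sum_nat_const.
apply: (@leq_trans (\sum_(x in X) \sum_(t in S | D t == x) 1)).
  apply: leq_sum => x xX; have [y xy yS] := outX x xX.
  apply: (@leq_trans #|guards x|).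
    rewrite -add1n -(cards1 y); apply: guards_demand.
      exact: bord_out (XS x xX) yS xy.
    by move=> z /set1P->; rewrite xy.
  rewrite sum1dep_card; apply/subset_leq_card/subsetP=> t /guardP[tS Dt _].
  by rewrite inE tS Dt eqxx.
rewrite -sum1_card [leqRHS](bigID (fun t => D t \in X)) /=.
rewrite [X in _ <= X + _](partition_big D (mem X)) => [|t /andP[]//].
rewrite -[leqLHS]addn0 leq_add //; apply: leq_sum => x xX.
rewrite !sum1dep_card; apply/subset_leq_card/subsetP => t.
by rewrite !inE => /andP[-> /eqP->]; rewrite xX eqxx.
Qed.

End Guards.

(** * Charts *)

Definition lattice_adj (p q : nat * nat) : bool :=
  (p.1 == q.1) && ((p.2.+1 == q.2) || (q.2.+1 == p.2))
  || (p.2 == q.2) && ((p.1.+1 == q.1) || (q.1.+1 == p.1)).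

Record grid_chart (G : graph) (m n : nat) (r c : G -> nat) : Prop := GridChart {
  chart_row x : r x < m;
  chart_col x : c x < n;
  chart_inj x y : r x = r y -> c x = c y -> x = y;
  chart_onto a b : a < m -> b < n -> exists x, r x = a /\ c x = b;
  chart_adj x y : adj x y = lattice_adj (r x, c x) (r y, c y) }.

Lemma grid_chart_swap {G : graph} {m n r c} :
  @grid_chart G m n r c -> grid_chart n m c r.
Proof.
case=> rx cx inj onto adjE; split=> // [x y ? ?|a b an bm|x y].
- exact: inj.
- by have [x []] := onto b a bm an; exists x.
- by rewrite adjE /lattice_adj /= orbC.
Qed.

Section ChartGeometry.
Variables (G : graph) (m n : nat) (r c : G -> nat).
Hypothesis chG : grid_chart m n r c.

Lemma leq_row_card i : i < m -> n <= #|[set x | r x == i]|.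
Proof.
move=> im; have /fin_all_exists[f fP] (j : 'I_n) := chart_onto chG im (ltn_ord j).
have injf : injective f.
  by move=> j j' ff; apply: val_inj; rewrite /= -(fP j).2 -(fP j').2 ff.
rewrite -[leqLHS]card_ord -(card_imset predT injf); apply/subset_leq_card.
by apply/subsetP=> _ /imsetP[j _ ->]; rewrite inE (fP j).1.
Qed.

(** A discrete intermediate value argument: if no vertex of S in this row had
    an outside neighbour, membership in S would propagate along the row from
    its vertex [o] in column 0, and would be constant on the row. *)
Lemma row_exit (S : {set G}) x y : x \in S -> y \notin S -> r x = r y ->
  exists z, [/\ z \in S, r z = r x & exists2 w, adj z w & w \notin S].
Proof.
move=> xS yS rxy; have rm := chart_row chG x; have := chart_col chG x.
case: (posnP n) => [->//|n0 _]; have [o [ro co]] := chart_onto chG rm n0.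
case: (boolP [exists z in S, (r z == r x) && [exists w, adj z w && (w \notin S)]]).
  case/exists_inP=> z zS /andP[/eqP rz /existsP[w /andP[zw wS]]].
  by exists z; split=> //; exists w.
move=> /exists_inPn nex.
have noexit z w : z \in S -> r z = r x -> adj z w -> w \in S.
  move=> zS rz zw; apply/contraT=> wS; have /negP[] := nex z zS.
  by rewrite rz eqxx; apply/existsP; exists w; rewrite zw.
have const z : r z = r x -> (z \in S) = (o \in S).
  move: {2}(c z) (erefl (c z)) => j; elim: j z => [|j IH] z cz rz.
    by congr (_ \in S); apply: (chart_inj chG); rewrite ?ro ?co //; lia.
  have jn : j < n by have := chart_col chG z; lia.
  have [w [rw cw]] := chart_onto chG rm jn.
  rewrite -(IH w) ?cw //.
  have zw : adj z w by rewrite (chart_adj chG) /lattice_adj /=; lia.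
  by apply/idP/idP => ?; [apply: (noexit z) | apply: (noexit w); rewrite // adj_sym].
by move: yS; rewrite (const y) // -(const x) // xS.
Qed.

End ChartGeometry.

(** * Quadrants cut off by a missing row and a missing column *)

Section Peak.
Variables (G : graph) (S : {set G}) (D : {ffun G -> G}).
Hypothesis defD : ultra_defense 1 S D.

(** When the demand of x equals the number of positions at which a guard can
    stand, all of them are occupied. Positions are listed by coordinates, and a
    position below 0, written with a truncated predecessor, is the position of
    x again; so [uniq L] shows that it does not occur when [L] also lists x. *)
Lemma guards_fill {m n} {r c : G -> nat} x (O : {set G}) (L : seq (nat * nat)) :
    grid_chart m n r c -> x \in S -> 0 < #|O| ->
    {in O, forall y, adj x y && (y \notin S)} -> size L <= #|O|.+1 ->
    (forall t, t \in S -> D t = x -> t = x \/ adj x t -> (r t, c t) \in L) ->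
  uniq L /\ {in L, forall l, exists t, [/\ t \in S, D t = x & (r t, c t) = l]}.
Proof.
move=> chG xS O0 outO sL subL.
have [y yO] := card_gt0P O0; have /andP[xy yS] := outO y yO.
have demand := guards_demand defD (bord_out xS yS xy) outO.
pose f t := (r t, c t).
have injf : injective f by move=> t u [??]; apply: (chart_inj chG).
have uF : uniq (map f (enum (guards S D x))) by rewrite map_inj_uniq ?enum_uniq.
have FL : {subset map f (enum (guards S D x)) <= L}.
  move=> l /mapP[t]; rewrite mem_enum => /(guardP defD)[tS Dt nt] ->.
  exact: subL.
have sF : size L <= size (map f (enum (guards S D x))).
  by rewrite size_map -cardE; lia.
split; first exact: leq_size_uniq uF FL sF.
move=> l; have [_ <-] := uniq_min_size uF FL sF => /mapP[t].
by rewrite mem_enum => /(guardP defD)[tS Dt _] ->; exists t.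
Qed.

Definition peak (r c : G -> nat) (a b : nat) (x : G) : Prop :=
  [/\ x \in S, r x < a, c x < b & forall y, y \in S -> r y < a -> c y < b ->
        r y + c y <= r x + c x].

Definition blank_lines (r c : G -> nat) a b : Prop :=
  {in S, forall y, r y <> a /\ c y <> b}.

(** Both steps away from the origin leave S, either by maximality or because
    they reach a blank line. So x needs three guards, and the only possible
    ones are x and its two neighbours towards the origin. *)
Lemma peak_guards {m n r c a b x} : grid_chart m n r c -> a < m -> b < n ->
    blank_lines r c a b -> peak r c a b x ->
  [/\ D x = x,
      exists y, [/\ y \in S, D y = x, (r y).+1 = r x & c y = c x] &
      exists z, [/\ z \in S, D z = x, r z = r x & (c z).+1 = c x]].
Proof.
move=> chG am bn blank [xS xa xb top].
have [||p [rp cp]] := @chart_onto _ _ _ _ _ chG (r x).+1 (c x); try lia.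
have [||q [rq cq]] := @chart_onto _ _ _ _ _ chG (r x) (c x).+1; try lia.
have pS : p \notin S.
  by apply/negP=> pS; have [] := blank p pS; have := top p pS; lia.
have qS : q \notin S.
  by apply/negP=> qS; have [] := blank q qS; have := top q qS; lia.
have pq : p != q by apply: contra_eqN rp => /eqP->; rewrite rq; lia.
have [||||uL fill] := @guards_fill m n r c x [set p; q]
    [:: (r x, c x); ((r x).-1, c x); (r x, (c x).-1)] chG xS.
- by rewrite cards2 pq.
- move=> y; rewrite !inE => /orP[] /eqP->;
    rewrite ?pS ?qS (chart_adj chG) /lattice_adj /=; lia.
- by rewrite cards2 pq.
- move=> t tS _ [->|]; first by rewrite inE eqxx.
  rewrite (chart_adj chG) /lattice_adj /= !inE !xpair_eqE.
  have tp : r t <> (r x).+1 \/ c t <> c x.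
    have [rt|] := eqVneq (r t) (r x).+1; last by left; apply/eqP.
    right=> ct; case/negP: pS; rewrite -(@chart_inj _ _ _ _ _ chG t p) //; lia.
  have tq : r t <> r x \/ c t <> (c x).+1.
    have [rt|] := eqVneq (r t) (r x); last by left; apply/eqP.
    right=> ct; case/negP: qS; rewrite -(@chart_inj _ _ _ _ _ chG t q) //; lia.
  lia.
have r0 : 0 < r x by move: uL; rewrite /= !inE !xpair_eqE; lia.
have c0 : 0 < c x by move: uL; rewrite /= !inE !xpair_eqE; lia.
have [|t [tS Dt [rt ct]]] := fill (r x, c x); first by rewrite inE eqxx.
have [|y [yS Dy [ry cy]]] := fill ((r x).-1, c x); first by rewrite !inE eqxx orbT.
have [|z [zS Dz [rz cz]]] := fill (r x, (c x).-1); first by rewrite !inE eqxx !orbT.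
split.
- by rewrite -[in LHS](@chart_inj _ _ _ _ _ chG t x rt ct).
- by exists y; split=> //; lia.
- by exists z; split=> //; lia.
Qed.

(** Here y, the neighbour of x in the previous row, is itself on the border and
    guards x, as does x. So y draws its two guards from its two neighbours
    towards the origin, one of which is the vertex w diagonal to x. *)
Lemma peak_inner_guard {m n r c a b x} : grid_chart m n r c -> a < m -> b < n ->
    blank_lines r c a b -> peak r c a b x ->
  exists w y, [/\ D w = y, (r y).+1 = r x, c y = c x,
                  (r w).+1 = r x & (c w).+1 = c x].
Proof.
move=> chG am bn blank pk; have [xS xa xb top] := pk.
have [Dx [y [yS Dy ry cy]] _] := peak_guards chG am bn blank pk.
have [z [_ _ _ cz]] := (let: And3 _ _ H := peak_guards chG am bn blank pk in H).
have [||p [rp cp]] := @chart_onto _ _ _ _ _ chG (r y) (c x).+1; try lia.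
have pS : p \notin S.
  (* Otherwise p would be a peak too, and y would guard both p and x. *)
  apply/negP=> pS; have [_ /eqP pb] := blank p pS.
  have pkp : peak r c a b p.
    by split=> // [||u uS ua ub]; [lia|lia|have := top u uS ua ub; lia].
  have [_ _ [u [uS Du ru cu]]] := peak_guards chG am bn blank pkp.
  have uy : u = y by apply: (chart_inj chG); lia.
  have := Dy; rewrite -uy Du => px; move: rp; rewrite px; lia.
have [||||_ fill] := @guards_fill m n r c y [set p]
    [:: ((r y).-1, c y); (r y, (c y).-1)] chG yS.
- by rewrite cards1.
- by move=> _ /set1P->; rewrite pS (chart_adj chG) /lattice_adj /=; lia.
- by rewrite cards1.
- move=> t tS Dt [ty|].
    have := Dt; rewrite ty Dy => xy; move: ry; rewrite xy; lia.
  rewrite (chart_adj chG) /lattice_adj /= !inE !xpair_eqE.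
  have tx : r t <> r x \/ c t <> c x.
    have [rt|] := eqVneq (r t) (r x); last by left; apply/eqP.
    right=> ct; have tx := chart_inj chG rt ct.
    have := Dt; rewrite tx Dx => xy; move: ry; rewrite xy; lia.
  have tp : r t <> r p \/ c t <> c p.
    have [rt|] := eqVneq (r t) (r p); last by left; apply/eqP.
    by right=> ct; case/negP: pS; rewrite -(chart_inj chG rt ct).
  lia.
have [|w [_ Dw [rw cw]]] := fill (r y, (c y).-1); first by rewrite !inE eqxx orbT.
by exists w, y; split=> //; lia.
Qed.

(** At a peak x, the previous lemma in the chart and in its transpose yields the
    same w, guarding both the vertical and the horizontal neighbour of x. *)
Lemma quadrant_empty {m n r c a b} : grid_chart m n r c -> a < m -> b < n ->
    blank_lines r c a b ->
  forall x, x \in S -> r x < a -> c x < b -> False.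
Proof.
move=> chG am bn blank x0 x0S x0a x0b.
pose P := [pred x in S | (r x < a) && (c x < b)].
have Px0 : P x0 by rewrite /= x0S x0a x0b.
case: (arg_maxnP (fun x => r x + c x) Px0) => x /and3P[xS xa xb] top.
have topx y : y \in S -> r y < a -> c y < b -> r y + c y <= r x + c x.
  by move=> yS ya yb; apply: top; rewrite /= yS ya yb.
have pk : peak r c a b x by split.
have pk' : peak c r b a x.
  by split=> // y yS yb ya; have := topx y yS ya yb; lia.
have blank' : blank_lines c r b a by move=> y /blank[].
have [w [y [Dw ry cy rw cw]]] := peak_inner_guard chG am bn blank pk.
have [w' [z [Dw' rz cz rw' cw']]] :=
  peak_inner_guard (grid_chart_swap chG) bn am blank' pk'.
have ww : w = w' by apply: (chart_inj chG); lia.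
have yz : y = z by rewrite -Dw -Dw' ww.
move: cz; rewrite -yz; lia.
Qed.

(** * Sets that meet every row *)

Lemma span_no_full_row {m n r c} : grid_chart m n r c ->
    (forall i, i < m -> exists2 x, x \in S & r x = i) ->
    (forall i, i < m -> exists2 x, x \notin S & r x = i) -> 2 * m <= #|S|.
Proof.
move=> chG meets misses.
have exitP (i : 'I_m) : exists z, [/\ z \in S, r z = i &
    exists2 w, adj z w & w \notin S].
  have [x xS rx] := meets i (ltn_ord i); have [y yS ry] := misses i (ltn_ord i).
  have rxy : r x = r y by rewrite rx ry.
  by have [z [zS rz ex]] := row_exit chG xS yS rxy; exists z; rewrite rz rx.
have [f fP] := fin_all_exists exitP.
have injf : injective f.
  move=> i j ff; apply: val_inj => /=.
  by have [_ <- _] := fP i; have [_ <- _] := fP j; rewrite ff.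
have := @leq_demand_card _ _ _ _ defD [set f i | i in 'I_m].
rewrite card_imset // card_ord mulnC; apply.
  by apply/subsetP=> _ /imsetP[i _ ->]; have [] := fP i.
by move=> _ /imsetP[i _ ->]; have [] := fP i.
Qed.

Lemma cross_exit {m n r c a b x} : grid_chart m n r c -> 2 < n ->
    {in S, forall y, r y = a \/ c y = b} -> r x <> a -> c x = b ->
  exists2 y, adj x y & y \notin S.
Proof.
move=> chG n3 cross rx cx; have xm := chart_row chG x; have xn := chart_col chG x.
have [j jb jn] : exists2 j, j.+1 = b \/ b.+1 = j & j < n.
  by case: (posnP b) => b0; [exists 1; lia | exists b.-1; lia].
have [y [ry cy]] := chart_onto chG xm jn.
exists y; first by rewrite (chart_adj chG) /lattice_adj /=; lia.
by apply/negP=> /cross[]; lia.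
Qed.

(** Below the bound, S has no room for anything but the full row and the full
    column. In this cross every vertex but the centre is on the border, which
    is more than half of S. *)
Lemma full_row_col {m n r c a b} : grid_chart m n r c -> 2 < m -> 2 < n ->
    a < m -> b < n -> (forall x, r x = a \/ c x = b -> x \in S) ->
  2 * minn m n <= #|S|.
Proof.
move=> chG m3 n3 am bn full; rewrite leqNgt; apply/negP=> small.
have [o [ro co]] := chart_onto chG am bn.
pose R := [set x | r x == a]; pose C := [set x | c x == b].
have Rn : n <= #|R| := leq_row_card chG am.
have Cm : m <= #|C| := leq_row_card (grid_chart_swap chG) bn.
have RC : #|R :&: C| <= 1.
  rewrite -(cards1 o); apply/subset_leq_card/subsetP => x.
  rewrite !inE => /andP[/eqP rx /eqP cx].
  by apply/eqP/(chart_inj chG); rewrite ?rx ?cx.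
have UI := cardsUI R C.
have crossS : R :|: C = S.
  apply/eqP; rewrite eqEcard; apply/andP; split; last by lia.
  apply/subsetP=> x; rewrite !inE => /orP[]/eqP ?; apply: full; [by left|by right].
have cross : {in S, forall y, r y = a \/ c y = b}.
  by move=> y; rewrite -crossS !inE => /orP[]/eqP; [left|right].
have oS : o \in S by apply: full; left.
have := @leq_demand_card _ _ _ _ defD (S :\ o).
have cS := cardsD1 o S; rewrite oS in cS.
rewrite subsetDl => /(_ isT) card2; suff: #|S :\ o| * 2 <= #|S|.
  by rewrite crossS in UI; lia.
apply: card2 => x /setD1P[xo xS].
have [rx|cx] := cross x xS.
  apply: (cross_exit (a := b) (grid_chart_swap chG) m3 _ _ rx).
    by move=> y /cross; tauto.
  by move=> cx; case/eqP: xo; apply: (chart_inj chG); lia.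
apply: (cross_exit chG n3 cross _ cx) => rx.
by case/eqP: xo; apply: (chart_inj chG); lia.
Qed.

Lemma span_rows {m n r c} : grid_chart m n r c -> 2 < m -> 2 < n ->
  (forall i, i < m -> exists2 x, x \in S & r x = i) -> 2 * minn m n <= #|S|.
Proof.
move=> chG m3 n3 meets.
have full_line m' n' r' c' : @grid_chart G m' n' r' c' ->
    (forall i, i < m' -> exists2 x, x \in S & r' x = i) ->
    2 * m' <= #|S| \/ exists2 a, a < m' & forall x, r' x = a -> x \in S.
  move=> ch meet; case: (boolP [exists a : 'I_m', [forall x, (r' x == a) ==> (x \in S)]]).
    case/existsP=> a /forallP fa; right; exists a => // x /eqP rx.
    exact: (implyP (fa x)).
  move=> /existsPn nofull; left; apply: (span_no_full_row ch) => // i im.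
  have /forallPn[x] := nofull (Ordinal im); rewrite negb_imply => /andP[/eqP rx xS].
  by exists x.
have [|[a am fulla]] := full_line _ _ _ _ chG meets; first lia.
have [||[b bn fullb]] := full_line _ _ _ _ (grid_chart_swap chG); last 1 first.
- by apply: (full_row_col chG m3 n3 am bn) => x []; [apply: fulla | apply: fullb].
- move=> j jn; have [x [rx cx]] := chart_onto chG am jn.
  by exists x => //; apply: fulla.
lia.
Qed.

End Peak.

(** * The grid of two paths *)

Lemma path_chart (m n : nat) (f : 'I_m -> 'I_m) (g : 'I_n -> 'I_n) :
    involutive f -> involutive g ->
    (forall i j, path_adj (f i) (f j) = path_adj i j) ->
    (forall i j, path_adj (g i) (g j) = path_adj i j) ->
  @grid_chart (path_graph m □ path_graph n) m n (fun x => f x.1) (fun x => g x.2).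
Proof.
move=> fK gK fA gA; split=> [x|x|[x1 x2] [y1 y2] /= e1 e2|a b am bn|[x1 x2] [y1 y2]].
- exact: ltn_ord.
- exact: ltn_ord.
- by congr (_, _); apply: (can_inj fK) || apply: (can_inj gK); apply: val_inj.
- by exists (f (Ordinal am), g (Ordinal bn)); rewrite /= fK gK.
- rewrite /= /cart_adj /lattice_adj /= -fA -gA /path_adj.
  by rewrite -(inj_eq (can_inj fK)) -(inj_eq (can_inj gK)).
Qed.

Lemma path_adj_rev m (i j : 'I_m) : path_adj (rev_ord i) (rev_ord j) = path_adj i j.
Proof.
by rewrite /path_adj /=; have := ltn_ord i; have := ltn_ord j; lia.
Qed.

(** The reflection that puts the side of [a] on which [i] lies below [a]. *)
Lemma reflect_below m (i a : 'I_m) : i <> a ->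
  exists f : 'I_m -> 'I_m, [/\ involutive f,
    forall i j, path_adj (f i) (f j) = path_adj i j & f i < f a].
Proof.
move=> ia; have [lt_ia|le_ai] := ltnP i a; first by exists id.
exists (@rev_ord m); split; [exact: rev_ordK|exact: path_adj_rev|].
have : i <> a :> nat by move/val_inj.
by rewrite /=; have := ltn_ord i; lia.
Qed.

Lemma ultra_secure_lower (m n : nat) (S : {set path_graph m □ path_graph n}) :
  2 < m -> 2 < n -> ultra_secure 1 S -> 2 * minn m n <= #|S|.
Proof.
move=> m3 n3 /andP[S0 /orP[/eqP->|/existsP[D defD]]].
  by rewrite cardsT card_prod !card_ord; nia.
have [x0 x0S] := set0Pn _ S0.
have idK k : involutive (@id 'I_k) by [].
have ch := path_chart (idK m) (idK n) (fun _ _ => erefl) (fun _ _ => erefl).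
case: (boolP [forall i : 'I_m, exists x in S, x.1 == i]) => [/forallP rows|].
  apply: (span_rows defD ch) => // i im.
  have /exists_inP[x xS /eqP xi] := rows (Ordinal im).
  by exists x; rewrite // xi.
case/forallPn=> a /exists_inPn blanka.
case: (boolP [forall j : 'I_n, exists x in S, x.2 == j]) => [/forallP cols|].
  rewrite minnC; apply: (span_rows defD (grid_chart_swap ch)) => // j jn.
  have /exists_inP[x xS /eqP xj] := cols (Ordinal jn).
  by exists x; rewrite // xj.
case/forallPn=> b /exists_inPn blankb.
have [f [fK fA fx]] := reflect_below (elimN eqP (blanka x0 x0S)).
have [g [gK gA gx]] := reflect_below (elimN eqP (blankb x0 x0S)).
case: (quadrant_empty defD (path_chart fK gK fA gA) (ltn_ord (f a))
  (ltn_ord (g b)) _ x0S fx gx) => y yS; split=> e.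
  by case/eqP: (blanka y yS); apply: (can_inj fK); apply: val_inj.
by case/eqP: (blankb y yS); apply: (can_inj gK); apply: val_inj.
Qed.

Definition two_columns (m n : nat) : {set path_graph m □ path_graph n} :=
  [set x : 'I_m * 'I_n | (x.2 : nat) < 2].

Lemma card_two_columns m n : 1 < n -> #|two_columns m n| = 2 * m.
Proof.
move=> n2.
have -> : two_columns m n = setX [set: 'I_m] [set j : 'I_n | j < 2].
  by apply/setP=> x; rewrite !inE.
rewrite cardsX cardsT card_ord mulnC; congr (_ * _).
have -> : [set j : 'I_n | j < 2] = [set Ordinal (ltnW n2); Ordinal n2].
  apply/setP=> j; rewrite !inE -!val_eqE /=; lia.
by rewrite cards2.
Qed.

Lemma two_columns_secure m n : 1 < m -> 2 < n -> ultra_secure 1 (two_columns m n).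
Proof.
move=> m2 n3; pose S := two_columns m n; rewrite /ultra_secure.
have n2 : 1 < n by lia.
pose pt i j : path_graph m □ path_graph n := (i, j).
pose i0 := Ordinal (ltnW m2); pose j0 := Ordinal (ltnW n2); pose j1 := Ordinal n2.
pose j2 := Ordinal n3.
apply/andP; split; first by apply/set0Pn; exists (pt i0 j0); rewrite inE.
apply/orP; right; apply/existsP; exists [ffun x => pt x.1 j1].
have bordE x : (x \in bord S) = (x.2 == j1).
  rewrite !inE; apply/andP/eqP => [[x2 /set0Pn[y]]|].
    rewrite !inE => /andP[y2 /orP[/eqP yx|]]; first by rewrite yx x2 in y2.
    rewrite /= /cart_adj /= /path_adj => xy; apply: val_inj => /=.
    case/orP: xy => /andP[/eqP e]; last by rewrite e in x2; rewrite x2 in y2.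
    by lia.
  move=> x2; rewrite x2; split=> //; apply/set0Pn; exists (pt x.1 j2).
  by rewrite !inE /= /cart_adj /= /path_adj /= x2 eqxx orbT.
have domE i (j : 'I_n) : j < 2 -> pt i j \in defense_dom S.
  move=> j2'; rewrite inE inE j2' andbT; apply/bigcupP; exists (pt i j1).
    by rewrite bordE.
  rewrite !inE /= /cart_adj /= /path_adj /= eqxx.
  rewrite xpair_eqE eqxx -val_eqE /=; lia.
apply/and3P; split.
- apply: (@leq_trans #|[set pt (Ordinal m2) j0; pt i0 j1]|); first by rewrite cards2.
  apply: leq_trans (leq_bigmax (pt i0 j0)); apply/subset_leq_card/subsetP=> x.
  by rewrite !inE => /orP[]/eqP->.
- apply/forall_inP=> y; rewrite inE ffunE bordE eqxx => /andP[_]; rewrite inE => y2 /=.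
  case: y y2 => i j /= y2; rewrite /cart_adj /= /path_adj /=.
  rewrite !xpair_eqE !eqxx -!val_eqE /=.
  lia.
apply/forallP=> A; apply/implyP=> /forall_inP attA; apply/forall_inP=> x.
rewrite bordE => /eqP x2.
apply: (@leq_trans #|[set pt x.1 j0; pt x.1 j1]|).
  rewrite cards2 xpair_eqE eqxx /= addn1 ltnS.
  rewrite -(cards1 (pt x.1 j2)); apply/subset_leq_card/subsetP=> y.
  rewrite inE => /andP[yb /eqP Ay]; have /andP[_] := attA y yb; rewrite Ay.
  move: yb; rewrite !inE => /andP[yS _]; case: x y x2 yS {Ay} => xi xj [yi yj] /= ->.
  rewrite /cart_adj /= /path_adj /= xpair_eqE -!val_eqE /=; lia.
apply/subset_leq_card/subsetP=> y /set2P[]->;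
  rewrite inE domE // ffunE; apply/eqP; by case: x x2 => xi xj /= ->.
Qed.

Theorem theorem4p3 (m n : nat) (hm : 3 <= m) (hmn : m <= n) :
  ultra_security_number (path_graph m □ path_graph n) 1 = 2 * m.
Proof.
have n3 : 2 < n by lia.
rewrite /ultra_security_number; case: arg_minnP => [|S secS minS].
  by case/andP: (two_columns_secure (ltnW hm) n3) => /set0Pn[x _] _;
    rewrite /ultra_secure eqxx andbT; apply/set0Pn; exists x; rewrite inE.
apply/eqP; rewrite eqn_leq; apply/andP; split.
  rewrite -(card_two_columns m (ltnW n3)); apply: minS.
  exact: two_columns_secure (ltnW hm) n3.
by have := ultra_secure_lower hm n3 secS; rewrite (minn_idPl hmn).
Qed.
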